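(* Let $\varphi\in C^{\infty}(\mathbb{R})$ be an even function such that $\varphi'(1)>0$ and $\varphi''(1)=0$. Then there exist real numbers $k_{1},k_{2},h_{1},h_{2}$ such that, for every open set $\Omega\subseteq\mathbb{R}^{2}$ with $(0,0)\in\Omega$ and every function $u_{0}:\Omega\to\mathbb{R}$ of class $C^{3}$ satisfying $$u_{0}(x,y)=\frac{\sqrt{2}}{2}x+\frac{\sqrt{2}}{2}y+k_{1}x^{2}+k_{2}y^{2}+h_{1}x^{3}+h_{2}y^{3}+o\left((x^{2}+y^{2})^{3/2}\right)\quad\text{as }(x,y)\to(0,0)$$ (so that in particular $|\nabla u_{0}(0,0)|=1$), the following properties hold true. (1) There exist $\delta>0$, $a>0$, and a convex function $g:(-\delta,\delta)\to(-a,a)$ such that $$\left\{(x,y)\in(-\delta,\delta)\times(-a,a):|\nabla u_{0}(x,y)|>1\right\}=\left\{(x,y)\in(-\delta,\delta)\times(-a,a):y>g(x)\right\}.$$ (2) Let $T>0$, and let $u\in C^{2}(\Omega\times[0,T))$ be a function satisfying $$u_{t}=\mathrm{div}\left(\varphi'\left(|\nabla u|\right)\frac{\nabla u}{|\nabla u|}\right)\quad\text{in }\Omega\times[0,T),$$ and the initial condition $u(x,y,0)=u_{0}(x,y)$ for every $(x,y)\in\Omega$. Then there exists $t_{0}\in(0,T)$ such that $$|\nabla u(0,0,t)|>1\quad\quad\forall t\in(0,t_{0}).$$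
   Context: The gradient $\nabla$ and the divergence are taken with respect to the space variables $(x,y)$ only. Derivatives in $t$ at $t=0$ are one-sided. The vector field $p\mapsto\varphi'(|p|)\,p/|p|$ on $\mathbb{R}^2$ is extended by $0$ at $p=0$ (recall that $\varphi$ even implies $\varphi'(0)=0$). *)

(* Defs.v *)
From Stdlib Require Export Reals.
From Coquelicot Require Export Coquelicot.
Open Scope R_scope.

(* Functions on a subset of R^2 or R^3 are represented by total functions;
   every hypothesis and conclusion only looks at their values on the subset. *)

Definition even_fun (f : R -> R) : Prop := forall x, f (- x) = f x.

Definition smooth (f : R -> R) : Prop := forall (n : nat) (x : R), ex_derive_n f n x.

Definition convex_on (D : R -> Prop) (g : R -> R) : Prop :=
  forall x y l : R, D x -> D y -> 0 <= l <= 1 ->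
    g (l * x + (1 - l) * y) <= l * g x + (1 - l) * g y.

Definition dx (f : R -> R -> R) (x y : R) : R := Derive (fun z => f z y) x.
Definition dy (f : R -> R -> R) (x y : R) : R := Derive (fun z => f x z) y.

Definition norm2 (p q : R) : R := sqrt (p ^ 2 + q ^ 2).

Definition grad_norm (f : R -> R -> R) (x y : R) : R :=
  norm2 (dx f x y) (dy f x y).

(* First and second component of the field p |-> phi'(|p|) p / |p|.  At p = 0
   the numerator vanishes, so the value there is 0 whatever [/ 0] is. *)
Definition flux1 (phi : R -> R) (p q : R) : R :=
  Derive phi (norm2 p q) * p / norm2 p q.
Definition flux2 (phi : R -> R) (p q : R) : R :=
  Derive phi (norm2 p q) * q / norm2 p q.

(* div (phi'(|grad f|) grad f / |grad f|); for f of class C^2 and phi smooth and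
   even, the flux is of class C^1, so both [Derive]s are genuine derivatives. *)
Definition div_flux (phi : R -> R) (f : R -> R -> R) (x y : R) : R :=
  dx (fun a b => flux1 phi (dx f a b) (dy f a b)) x y +
  dy (fun a b => flux2 phi (dx f a b) (dy f a b)) x y.

(* Derivative along D: two-sided at interior points of D, one-sided at its
   endpoints. *)
Definition is_derive_within (D : R -> Prop) (f : R -> R) (t l : R) : Prop :=
  filterlim (fun s => (f s - f t) / (s - t)) (within D (locally' t)) (locally l).

Definition time_interval (T : R) (t : R) : Prop := 0 <= t < T.

Definition cyl (Omega : R * R -> Prop) (T : R) (p : R * R * R) : Prop :=
  Omega (fst p) /\ time_interval T (snd p).

(* u is of class C^n on Omega x [0,T), for Omega open: all iterated partial
   derivatives of order at most n exist and are continuous there, the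
   derivatives in t at t = 0 being one-sided. *)
Fixpoint Ck_cyl (n : nat) (Omega : R * R -> Prop) (T : R)
    (u : R -> R -> R -> R) : Prop :=
  (forall x y t, cyl Omega T (x, y, t) ->
     filterlim (fun p : R * R * R => u (fst (fst p)) (snd (fst p)) (snd p))
       (within (cyl Omega T) (locally (x, y, t))) (locally (u x y t))) /\
  match n with
  | O => True
  | S m => exists ux uy ut : R -> R -> R -> R,
      (forall x y t, cyl Omega T (x, y, t) ->
         is_derive (fun z => u z y t) x (ux x y t) /\
         is_derive (fun z => u x z t) y (uy x y t) /\
         is_derive_within (time_interval T) (fun s => u x y s) t (ut x y t)) /\
      Ck_cyl m Omega T ux /\ Ck_cyl m Omega T uy /\ Ck_cyl m Omega T ut
  end.

(* Main.v *)
Require Import Defs.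
From Stdlib Require Import Lra.

(** The coefficients are [k1 = 0], [k2 = 1], [h1 = - 1] and [h2] large.

    The expansion determines the derivatives of [u0] at the origin up to order 3
    ([jet_of_expansion]): the gradient is [(sqrt 2 / 2, sqrt 2 / 2)], the only
    nonzero second derivative is [u_yy = 2], and the only nonzero third
    derivatives are [u_xxx = - 6] and [u_yyy = 6 * h2].

    Part (1).  Let [F] be the square of the norm of the gradient of [u0].  At the
    origin [F = 1], [Fx = 0], [Fy = 2 * sqrt 2 > 0] and [Fxx = - 6 * sqrt 2 < 0].
    So the level set [F = 1] is locally the graph of a function [g] with
    [g'(0) = 0] and [g''(0) = - Fxx / Fy = 3 > 0], and [F > 1] above the graph.
    Convexity of [g] is derived in [superlevel_convex_epigraph] from the sign of
    the second derivative of [F] along chords.  None of these values depends on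
    [h2], which is thus free for the second part.

    Part (2).  Let [E] be the divergence of the flux of [u0], which is the time
    derivative of [u] at time 0.  With [c = phi'(1)] and [d = phi'''(1)], and since
    [phi''(1) = 0], the gradient of [E] at the origin is
    [(- 3 * c, 3 * c * h2 + sqrt 2 * (d - 3 * c))] ([div_flux_gradient_at_jet]).
    The derivative at time 0 of the gradient of [u] at the origin is the gradient
    of [E] ([gradient_growth], an exchange of one-sided mixed derivatives), so the
    derivative of the square of its norm is [sqrt 2 * (E_x + E_y)].  As [c > 0],
    this is positive for [h2] large. *)

(** * Uniqueness of cubic expansions *)

Lemma zero_of_linear_bound (c K d : R) :
  0 < d -> (forall s, 0 < s < d -> Rabs c <= K * s) -> c = 0.
Proof.
intros Hd H.
destruct (Req_dec c 0) as [->|Hc]; [reflexivity|exfalso].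
pose proof (Rabs_pos_lt c Hc) as Hp.
assert (HK : 0 < Rabs K + 1) by (pose proof (Rabs_pos K); lra).
pose (s := Rmin (d / 2) (Rabs c / (2 * (Rabs K + 1)))).
assert (Hq : 0 < Rabs c / (2 * (Rabs K + 1))) by (apply Rdiv_lt_0_compat; lra).
assert (Hs0 : 0 < s) by (apply Rmin_pos; lra).
assert (Hs1 : s <= d / 2) by apply Rmin_l.
assert (Hs2 : s <= Rabs c / (2 * (Rabs K + 1))) by apply Rmin_r.
assert (Hs3 : s * (2 * (Rabs K + 1)) <= Rabs c).
{ apply Rle_trans with (Rabs c / (2 * (Rabs K + 1)) * (2 * (Rabs K + 1))).
  - apply Rmult_le_compat_r; lra.
  - right; field; lra. }
specialize (H s ltac:(lra)).
pose proof (Rle_abs K). nra.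
Qed.

(** Two cubic expansions of the same function agree: this is applied to the
    difference of the Taylor polynomial and of the prescribed polynomial along
    a ray. *)
Lemma cubic_littleo_zero (c0 c1 c2 c3 : R) :
  (forall eps, 0 < eps -> exists d, 0 < d /\ forall s, 0 < s < d ->
     Rabs (c0 + c1 * s + c2 * s ^ 2 + c3 * s ^ 3) <= eps * s ^ 3) ->
  c0 = 0 /\ c1 = 0 /\ c2 = 0 /\ c3 = 0.
Proof.
intros H.
destruct (H 1 Rlt_0_1) as [d0 [Hd0 H1]].
pose (d := Rmin d0 1).
assert (Hd : 0 < d) by (apply Rmin_pos; lra).
assert (Hdd : d <= d0) by apply Rmin_l.
assert (Hd1 : d <= 1) by apply Rmin_r.
assert (B : forall s, 0 < s < d ->
  - s ^ 3 <= c0 + c1 * s + c2 * s ^ 2 + c3 * s ^ 3 <= s ^ 3).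
{ intros s Hs. specialize (H1 s ltac:(lra)). apply Rabs_le_between in H1. lra. }
clear H1.
pose proof (Rabs_pos c1) as P1. pose proof (Rabs_pos c2) as P2.
pose proof (Rabs_pos c3) as P3.
assert (A : forall c s, 0 < s -> - (Rabs c * s) <= c * s <= Rabs c * s).
{ intros c s Hs. pose proof (Rle_abs c). pose proof (Rle_abs (- c)) as Q.
  rewrite Rabs_Ropp in Q. nra. }
assert (E0 : c0 = 0).
{ apply (zero_of_linear_bound c0 (Rabs c1 + Rabs c2 + Rabs c3 + 1) d Hd).
  intros s Hs. specialize (B s Hs).
  pose proof (A c1 s ltac:(lra)).
  assert (S2 : 0 < s ^ 2 <= s) by nra.
  assert (S3 : 0 < s ^ 3 <= s) by nra.
  pose proof (A c2 (s ^ 2) ltac:(lra)). pose proof (A c3 (s ^ 3) ltac:(lra)).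
  apply Rabs_le. nra. }
subst c0.
assert (E1 : c1 = 0).
{ apply (zero_of_linear_bound c1 (Rabs c2 + Rabs c3 + 1) d Hd).
  intros s Hs. specialize (B s Hs).
  assert (S2 : 0 < s ^ 2 <= s) by nra.
  pose proof (A c2 s ltac:(lra)). pose proof (A c3 (s ^ 2) ltac:(lra)).
  assert (B' : - s ^ 2 <= c1 + c2 * s + c3 * s ^ 2 <= s ^ 2).
  { split; apply Rmult_le_reg_r with s; lra. }
  apply Rabs_le. nra. }
subst c1.
assert (E2 : c2 = 0).
{ apply (zero_of_linear_bound c2 (Rabs c3 + 1) d Hd).
  intros s Hs. specialize (B s Hs).
  assert (S2 : 0 < s ^ 2 <= s) by nra.
  pose proof (A c3 s ltac:(lra)).
  assert (B' : - s <= c2 + c3 * s <= s).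
  { split; apply Rmult_le_reg_r with (s ^ 2); lra. }
  apply Rabs_le. nra. }
subst c2.
repeat split; trivial.
destruct (Req_dec c3 0) as [->|Hc]; [reflexivity|exfalso].
pose proof (Rabs_pos_lt c3 Hc) as Hp.
destruct (H (Rabs c3 / 2) ltac:(lra)) as [e [He H2]].
specialize (H2 (e / 2) ltac:(lra)).
assert (S3 : 0 < (e / 2) ^ 3) by (apply pow_lt; lra).
replace (0 + 0 * (e / 2) + 0 * (e / 2) ^ 2 + c3 * (e / 2) ^ 3)
  with (c3 * (e / 2) ^ 3) in H2 by ring.
rewrite Rabs_mult, (Rabs_pos_eq ((e / 2) ^ 3)) in H2 by lra. nra.
Qed.

(** * Jets and derivatives along lines *)

Lemma open_ex_diff_n (Omega : R * R -> Prop) f n x y :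
  open Omega -> (forall x y, Omega (x, y) -> ex_diff_n f n x y) -> Omega (x, y) ->
  locally_2d (ex_diff_n f n) x y.
Proof.
intros Ho Hf Hxy. apply locally_2d_locally.
generalize (Ho (x, y) Hxy). apply filter_imp. intros [u v]. apply Hf.
Qed.

Lemma locally_2d_ex_diff_n_le f g n m x y :
  (forall u v, ex_diff_n f n u v -> ex_diff_n g m u v) ->
  locally_2d (ex_diff_n f n) x y -> locally_2d (ex_diff_n g m) x y.
Proof. intros H. apply locally_2d_impl, locally_2d_forall. exact H. Qed.

Lemma ex_diff_n_dx h n x y : ex_diff_n h (S n) x y -> ex_diff_n (dx h) n x y.
Proof. exact (ex_diff_n_deriv_aux1 h n x y). Qed.

Lemma ex_diff_n_dy h n x y : ex_diff_n h (S n) x y -> ex_diff_n (dy h) n x y.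
Proof. exact (ex_diff_n_deriv_aux2 h n x y). Qed.

Lemma ex_diff_n_continuity h n x y : ex_diff_n h n x y -> continuity_2d_pt h x y.
Proof. destruct n; simpl; tauto. Qed.

Lemma dx_dy_comm f x y :
  locally_2d (ex_diff_n f 2) x y -> dx (dy f) x y = dy (dx f) x y.
Proof.
intros H. unfold dx, dy. apply Schwarz.
- revert H. apply locally_2d_impl, locally_2d_forall. intros u v Huv.
  simpl in Huv. tauto.
- apply locally_2d_singleton in H. simpl in H. tauto.
- apply locally_2d_singleton in H. simpl in H. tauto.
Qed.

Lemma locally_2d_locally_2d P x y :
  locally_2d P x y -> locally_2d (locally_2d P) x y.
Proof.
intros H. revert H. apply locally_2d_impl_strong, locally_2d_forall. auto.
Qed.

(** Schwarz's theorem for the two first partial derivatives, together with the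
    derivatives of the identity [dx (dy f) = dy (dx f)] around the point. *)
Lemma third_partials_comm f x y :
  locally_2d (ex_diff_n f 3) x y ->
  (dx (dy (dx f)) x y = dx (dx (dy f)) x y /\
   dy (dx (dx f)) x y = dx (dx (dy f)) x y) /\
  (dy (dx (dy f)) x y = dx (dy (dy f)) x y /\
   dy (dy (dx f)) x y = dx (dy (dy f)) x y).
Proof.
intros H.
assert (M : forall h n, (forall u v, ex_diff_n f 3 u v -> ex_diff_n h n u v) ->
  locally_2d (ex_diff_n h n) x y).
{ intros h n Hh. revert H. apply locally_2d_impl, locally_2d_forall. auto. }
assert (Sx : dx (dy (dx f)) x y = dy (dx (dx f)) x y).
{ apply dx_dy_comm, M. intros u v Huv. exact (ex_diff_n_deriv_aux1 f 2 u v Huv). }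
assert (Sy : dx (dy (dy f)) x y = dy (dx (dy f)) x y).
{ apply dx_dy_comm, M. intros u v Huv. exact (ex_diff_n_deriv_aux2 f 2 u v Huv). }
assert (L : locally_2d (fun u v => dx (dy f) u v = dy (dx f) u v) x y).
{ generalize (locally_2d_locally_2d _ _ _ (M f 2%nat (fun u v =>
    ex_diff_n_m 3 2 ltac:(auto) f u v))).
  apply locally_2d_impl, locally_2d_forall. intros u v. apply dx_dy_comm. }
assert (Lx : dx (dx (dy f)) x y = dx (dy (dx f)) x y).
{ apply Derive_ext_loc. exact (locally_2d_1d_const_y _ _ _ L). }
assert (Ly : dy (dx (dy f)) x y = dy (dy (dx f)) x y).
{ apply Derive_ext_loc. exact (locally_2d_1d_const_x _ _ _ L). }
repeat split; congruence.
Qed.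

(** Differentiability along every affine line, with the derivative given by the
    candidate gradient.  Restricting to lines reduces sums, products and Taylor
    expansions to the one-variable rules. *)
Definition has_grad (U : R -> R -> Prop) (f fx fy : R -> R -> R) : Prop :=
  forall x y a b s, U (x + s * a) (y + s * b) ->
    is_derive (fun r => f (x + r * a) (y + r * b)) s
      (fx (x + s * a) (y + s * b) * a + fy (x + s * a) (y + s * b) * b).

Lemma has_grad_C1 (U : R -> R -> Prop) f :
  (forall x y, U x y -> locally_2d (ex_diff_n f 1) x y) ->
  has_grad U f (dx f) (dy f).
Proof.
intros H x y a b s HU. specialize (H _ _ HU). clear HU.
apply is_derive_Reals.
apply (derivable_pt_lim_comp_2d f (fun r => x + r * a) (fun r => y + r * b)).
- apply filterdiff_differentiable_pt_lim.
  apply filterdiff_ext_lin with (fun u : R * R =>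
    plus (scal (fst u) (dx f (x + s * a) (y + s * b)))
         (scal (snd u) (dy f (x + s * a) (y + s * b)))).
  2: { intros [u v]. reflexivity. }
  apply (is_derive_filterdiff f _ _ (dx f)).
  + apply (locally_2d_locally
      (fun u v => is_derive (fun z => f z v) u (dx f u v))).
    revert H. apply locally_2d_impl, locally_2d_forall. intros u v Huv.
    apply Derive_correct. simpl in Huv. tauto.
  + apply Derive_correct. apply locally_2d_singleton in H. simpl in H. tauto.
  + apply (continuity_2d_pt_filterlim (dx f)).
    apply locally_2d_singleton in H. simpl in H. tauto.
- apply is_derive_Reals. auto_derive; trivial. ring.
- apply is_derive_Reals. auto_derive; trivial. ring.
Qed.

(** [auto_derive] leaves terms [Derive g x] for opaque functions [g]; this
    replaces one of them by the value that [H] gives. *)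
Ltac rewrite_Derive H :=
  match type of H with is_derive _ ?x ?l =>
    match goal with |- context [Derive ?g x] =>
      replace (Derive g x) with l by (symmetry; apply is_derive_unique; exact H)
    end
  end.

Lemma is_derive_lincomb (u v : R -> R) (s u' v' a b : R) :
  is_derive u s u' -> is_derive v s v' ->
  is_derive (fun r => u r * a + v r * b) s (u' * a + v' * b).
Proof.
intros Hu Hv.
auto_derive; [split; [now exists u'|split; [now exists v'|trivial]]|].
rewrite_Derive Hu. rewrite_Derive Hv. ring.
Qed.

(** The induction step for the remainder in Taylor's formula. *)
Lemma taylor_term (n : nat) (h dh : R -> R) (d eps : R) :
  (forall s, 0 <= s < d -> is_derive h s (dh s)) -> h 0 = 0 ->
  (forall s, 0 <= s < d -> Rabs (dh s) <= eps * s ^ n) -> 0 <= eps ->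
  forall s, 0 <= s < d -> Rabs (h s) <= eps * s ^ S n.
Proof.
intros Hh H0 B He s Hs.
destruct (Req_dec s 0) as [->|Hn].
{ rewrite H0, Rabs_R0. simpl. lra. }
destruct (MVT_cor2 h dh 0 s) as [r [E Hr]]; [lra| |].
{ intros c Hc. apply is_derive_Reals, Hh. lra. }
replace (h s) with (dh r * s) by lra.
rewrite Rabs_mult, (Rabs_pos_eq s) by lra.
specialize (B r ltac:(lra)).
assert (r ^ n <= s ^ n) by (apply pow_incr; lra).
simpl. apply Rle_trans with (eps * s ^ n * s); [|lra].
apply Rmult_le_compat_r; [lra|]. apply Rle_trans with (1 := B).
apply Rmult_le_compat_l; lra.
Qed.

(** Only continuity of the third derivative at 0 is available for a C^3
    function, so the remainder is a little-o of [s ^ 3] and not a big-O of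
    [s ^ 4].  The bound on the third derivative of the remainder is integrated
    three times. *)
Lemma taylor_peano_3 (g g1 g2 g3 : R -> R) (d : R) :
  0 < d ->
  (forall s, 0 <= s < d -> is_derive g s (g1 s)) ->
  (forall s, 0 <= s < d -> is_derive g1 s (g2 s)) ->
  (forall s, 0 <= s < d -> is_derive g2 s (g3 s)) ->
  continuity_pt g3 0 ->
  forall eps, 0 < eps -> exists e, 0 < e /\ forall s, 0 < s < e ->
    Rabs (g s - (g 0 + g1 0 * s + g2 0 / 2 * s ^ 2 + g3 0 / 6 * s ^ 3)) <= eps * s ^ 3.
Proof.
intros Hd H1 H2 H3 Hc eps He.
destruct (Hc eps He) as [e [He0 C]].
assert (Hm : 0 < Rmin d e) by (apply Rmin_pos; lra).
pose proof (Rmin_l d e) as Ml. pose proof (Rmin_r d e) as Mr.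
set (m := Rmin d e) in *.
assert (B3 : forall s, 0 <= s < m -> Rabs (g3 s - g3 0) <= eps * s ^ 0).
{ intros s Hs. simpl. rewrite Rmult_1_r.
  destruct (Req_dec s 0) as [->|Hn].
  - rewrite Rminus_diag, Rabs_R0. lra.
  - apply Rlt_le. apply (C s). split; [split; [exact I|lra]|].
    simpl. unfold Rdist. rewrite Rminus_0_r, Rabs_pos_eq; lra. }
assert (B2 : forall s, 0 <= s < m -> Rabs (g2 s - g2 0 - g3 0 * s) <= eps * s ^ 1).
{ apply (taylor_term 0 _ (fun s => g3 s - g3 0)); [|ring|exact B3|lra].
  intros s Hs. specialize (H3 s ltac:(lra)).
  auto_derive; [exists (g3 s); exact H3|].
  rewrite_Derive H3. ring. }
assert (B1 : forall s, 0 <= s < m ->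
  Rabs (g1 s - g1 0 - g2 0 * s - g3 0 / 2 * s ^ 2) <= eps * s ^ 2).
{ apply (taylor_term 1 _ (fun s => g2 s - g2 0 - g3 0 * s)); [|ring|exact B2|lra].
  intros s Hs. specialize (H2 s ltac:(lra)).
  auto_derive; [exists (g2 s); exact H2|].
  rewrite_Derive H2. field. }
exists m. split; [exact Hm|]. intros s Hs.
replace (g s - _) with (g s - g 0 - g1 0 * s - g2 0 / 2 * s ^ 2 - g3 0 / 6 * s ^ 3)
  by ring.
revert s Hs.
enough (B0 : forall s, 0 <= s < m ->
  Rabs (g s - g 0 - g1 0 * s - g2 0 / 2 * s ^ 2 - g3 0 / 6 * s ^ 3) <= eps * s ^ 3).
{ intros s Hs. apply B0. lra. }
apply (taylor_term 2 _ (fun s => g1 s - g1 0 - g2 0 * s - g3 0 / 2 * s ^ 2));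
  [|ring|exact B1|lra].
intros s Hs. specialize (H1 s ltac:(lra)).
auto_derive; [exists (g1 s); exact H1|].
rewrite_Derive H1. field.
Qed.

Lemma continuity_2d_on_line f a b :
  continuity_2d_pt f 0 0 -> continuity_pt (fun s => f (s * a) (s * b)) 0.
Proof.
intros H.
apply continuity_pt_filterlim.
apply (continuous_comp_2 (fun s : R => s * a) (fun s : R => s * b) f 0).
- apply (ex_derive_continuous (fun s : R => s * a)). auto_derive. trivial.
- apply (ex_derive_continuous (fun s : R => s * b)). auto_derive. trivial.
- rewrite !Rmult_0_l. apply continuity_2d_pt_filterlim, H.
Qed.

(** The Taylor polynomial of [f] and the given cubic differ by a little-o of the
    third power of the norm, hence coincide along every ray from the origin.
    The rays of directions (1,0), (0,1), (1,1) and (1,-1) separate the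
    coefficients of homogeneous polynomials of degree at most 3. *)
Lemma jet_of_expansion (f : R -> R -> R) (c10 c01 k1 k2 h1 h2 : R) :
  locally_2d (ex_diff_n f 3) 0 0 ->
  is_domin (locally (0, 0))
    (fun p : R * R => norm2 (fst p) (snd p) ^ 3)
    (fun p : R * R =>
       f (fst p) (snd p) -
       (c10 * fst p + c01 * snd p + k1 * fst p ^ 2 + k2 * snd p ^ 2
        + h1 * fst p ^ 3 + h2 * snd p ^ 3)) ->
  (dx f 0 0 = c10 /\ dy f 0 0 = c01) /\
  (dx (dx f) 0 0 = 2 * k1 /\ dx (dy f) 0 0 = 0 /\ dy (dy f) 0 0 = 2 * k2) /\
  (dx (dx (dx f)) 0 0 = 6 * h1 /\ dx (dx (dy f)) 0 0 = 0 /\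
   dx (dy (dy f)) 0 0 = 0 /\ dy (dy (dy f)) 0 0 = 6 * h2).
Proof.
intros Hf Hd.
set (U := locally_2d (ex_diff_n f 3)).
assert (G : forall h, (forall x y, ex_diff_n f 3 x y -> ex_diff_n h 1 x y) ->
  has_grad U h (dx h) (dy h)).
{ intros h Hh. apply has_grad_C1. intros x y Hxy. revert Hxy.
  apply locally_2d_impl, locally_2d_forall. auto. }
assert (S2 : forall x y, U x y -> dy (dx f) x y = dx (dy f) x y).
{ intros x y Hxy. symmetry. apply dx_dy_comm. revert Hxy.
  apply locally_2d_impl, locally_2d_forall. intros u v. now apply ex_diff_n_m; auto. }
pose proof ex_diff_n_dx as Jx. pose proof ex_diff_n_dy as Jy.
assert (J1 : forall h x y, ex_diff_n h 2 x y -> ex_diff_n h 1 x y)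
  by (intros h x y; apply ex_diff_n_m; auto).
assert (J2 : forall h x y, ex_diff_n h 3 x y -> ex_diff_n h 1 x y)
  by (intros h x y; apply ex_diff_n_m; auto).
assert (G1 := G f (J2 f)).
assert (Gx := G (dx f) ltac:(auto)).
assert (Gy := G (dy f) ltac:(auto)).
assert (Gxx := G (dx (dx f)) ltac:(auto)).
assert (Gxy := G (dx (dy f)) ltac:(auto)).
assert (Gyy := G (dy (dy f)) ltac:(auto)).
clear G.
assert (K : forall a b,
  c10 * a + c01 * b = dx f 0 0 * a + dy f 0 0 * b /\
  k1 * a ^ 2 + k2 * b ^ 2 =
   (dx (dx f) 0 0 * a ^ 2 + 2 * dx (dy f) 0 0 * a * b + dy (dy f) 0 0 * b ^ 2) / 2 /\
  h1 * a ^ 3 + h2 * b ^ 3 =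
   (dx (dx (dx f)) 0 0 * a ^ 3 + 3 * dx (dx (dy f)) 0 0 * a ^ 2 * b
    + 3 * dx (dy (dy f)) 0 0 * a * b ^ 2 + dy (dy (dy f)) 0 0 * b ^ 3) / 6).
{ intros a b.
  pose (D1 := fun x y => dx f x y * a + dy f x y * b).
  pose (D2 := fun x y => dx (dx f) x y * a ^ 2 + dx (dy f) x y * (2 * a * b)
    + dy (dy f) x y * b ^ 2).
  pose (D3 := fun x y => dx (dx (dx f)) x y * a ^ 3 + 3 * dx (dx (dy f)) x y * a ^ 2 * b
    + 3 * dx (dy (dy f)) x y * a * b ^ 2 + dy (dy (dy f)) x y * b ^ 3).
  set (M := Rabs a + Rabs b + 1).
  pose proof (Rabs_pos a) as Pa. pose proof (Rabs_pos b) as Pb.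
  assert (HM : 0 < M) by (unfold M; lra).
  assert (Ray : forall m s, 0 <= s < m / M ->
    Rabs (s * a - 0) < m /\ Rabs (s * b - 0) < m).
  { intros m s Hs.
    assert (HsM : s * M < m).
    { replace m with (m / M * M) by (field; lra). apply Rmult_lt_compat_r; lra. }
    rewrite !Rminus_0_r, !Rabs_mult, (Rabs_pos_eq s) by lra.
    unfold M in HsM. nra. }
  destruct (locally_2d_locally_2d _ _ _ Hf) as [r HU]. fold U in HU.
  assert (Hr : 0 < r / M) by (apply Rdiv_lt_0_compat; [apply cond_pos|lra]).
  assert (HU' : forall s, 0 <= s < r / M -> U (s * a) (s * b)).
  { intros s Hs. apply HU; apply (Ray r s Hs). }
  assert (Line : forall h hx hy, has_grad U h hx hy -> forall s, 0 <= s < r / M ->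
    is_derive (fun s => h (s * a) (s * b)) s (hx (s * a) (s * b) * a + hy (s * a) (s * b) * b)).
  { intros h hx hy Gh s Hs. specialize (Gh 0 0 a b s). rewrite !Rplus_0_l in Gh.
    generalize (Gh (HU' s Hs)).
    apply is_derive_ext. intros t. now rewrite !Rplus_0_l. }
  assert (T : forall eps, 0 < eps -> exists e, 0 < e /\ forall s, 0 < s < e ->
    Rabs (f (s * a) (s * b) - (f 0 0 + D1 0 0 * s + D2 0 0 / 2 * s ^ 2
       + D3 0 0 / 6 * s ^ 3)) <= eps * s ^ 3).
  { intros eps He.
    destruct (taylor_peano_3 (fun s => f (s * a) (s * b)) (fun s => D1 (s * a) (s * b))
      (fun s => D2 (s * a) (s * b)) (fun s => D3 (s * a) (s * b)) (r / M) Hr) with eps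
      as [e [He0 B]]; trivial.
    - exact (Line _ _ _ G1).
    - intros s Hs. unfold D1, D2.
      pose proof (Line _ _ _ Gx s Hs) as Lx. pose proof (Line _ _ _ Gy s Hs) as Ly.
      rewrite (S2 _ _ (HU' s Hs)) in Lx.
      evar_last; [exact (is_derive_lincomb _ _ _ _ _ _ _ Lx Ly)|]. simpl. ring.
    - intros s Hs. unfold D2, D3.
      destruct (third_partials_comm f _ _ (HU' s Hs)) as [[E1 E2] [E3 E4]].
      pose proof (Line _ _ _ Gxx s Hs) as Lx. pose proof (Line _ _ _ Gxy s Hs) as Lxy.
      pose proof (Line _ _ _ Gyy s Hs) as Ly.
      rewrite E2 in Lx. rewrite E3 in Lxy.
      pose proof (is_derive_lincomb _ _ _ _ _ (a ^ 2) (2 * a * b) Lx Lxy) as Lxxy.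
      evar_last.
      { apply (is_derive_ext (fun s => (dx (dx f) (s * a) (s * b) * a ^ 2
          + dx (dy f) (s * a) (s * b) * (2 * a * b)) * 1 + dy (dy f) (s * a) (s * b) * b ^ 2)).
        - intros t. simpl. ring.
        - exact (is_derive_lincomb _ _ _ _ _ _ _ Lxxy Ly). }
      simpl. ring.
    - apply (continuity_2d_on_line D3).
      apply locally_2d_singleton in Hf. simpl in Hf. unfold D3.
      repeat first [apply continuity_2d_pt_plus | apply continuity_2d_pt_mult
        | apply continuity_2d_pt_const]; unfold dx, dy; tauto.
    - exists e. split; [exact He0|]. intros s Hs. specialize (B s Hs).
      rewrite !Rmult_0_l in B. exact B. }
  assert (Z : f 0 0 = 0 /\ D1 0 0 - (c10 * a + c01 * b) = 0
     /\ D2 0 0 / 2 - (k1 * a ^ 2 + k2 * b ^ 2) = 0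
     /\ D3 0 0 / 6 - (h1 * a ^ 3 + h2 * b ^ 3) = 0).
  (* half of eps for the Taylor remainder, half for the hypothesis on f *)
  { apply cubic_littleo_zero. intros eps Heps.
    destruct (T (eps / 2) ltac:(lra)) as [e [He HT]].
    set (n3 := norm2 a b ^ 3).
    assert (Hn3 : 0 <= n3) by (apply pow_le, sqrt_pos).
    assert (He1 : 0 < eps / (2 * (n3 + 1))) by (apply Rdiv_lt_0_compat; lra).
    assert (Hd' := Hd (mkposreal _ He1)).
    apply (locally_2d_locally (fun x y => norm
       (f x y - (c10 * x + c01 * y + k1 * x ^ 2 + k2 * y ^ 2 + h1 * x ^ 3 + h2 * y ^ 3))
       <= mkposreal _ He1 * norm (norm2 x y ^ 3))) in Hd'.
    destruct Hd' as [r' Hd']. simpl pos in Hd'.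
    exists (Rmin e (r' / M)). split.
    { apply Rmin_pos; [exact He|]. apply Rdiv_lt_0_compat; [apply cond_pos|lra]. }
    intros s Hs.
    pose proof (Rmin_l e (r' / M)). pose proof (Rmin_r e (r' / M)).
    specialize (HT s ltac:(lra)).
    destruct (Ray r' s ltac:(lra)) as [R1 R2].
    specialize (Hd' (s * a) (s * b) R1 R2).
    assert (HN : norm2 (s * a) (s * b) ^ 3 = n3 * s ^ 3).
    { unfold n3. rewrite <- Rpow_mult_distr. f_equal. unfold norm2.
      replace ((s * a) ^ 2 + (s * b) ^ 2) with ((a ^ 2 + b ^ 2) * s ^ 2) by ring.
      rewrite sqrt_mult by nra. rewrite sqrt_pow2 by lra. reflexivity. }
    rewrite HN in Hd'.
    assert (Hs3 : 0 < s ^ 3) by (apply pow_lt; lra).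
    change norm with Rabs in Hd'.
    rewrite (Rabs_pos_eq (n3 * s ^ 3)) in Hd' by nra.
    assert (Hd2 : eps / (2 * (n3 + 1)) * (n3 * s ^ 3) <= eps / 2 * s ^ 3).
    { replace (eps / (2 * (n3 + 1)) * (n3 * s ^ 3))
        with (eps / 2 * s ^ 3 * (n3 / (n3 + 1))) by (field; lra).
      assert (n3 / (n3 + 1) <= 1).
      { apply Rmult_le_reg_r with (n3 + 1); [lra|]. unfold Rdiv.
        rewrite Rmult_assoc, Rinv_l; lra. }
      assert (0 < eps / 2 * s ^ 3) by (apply Rmult_lt_0_compat; lra). nra. }
    apply Rabs_le_between in Hd'. apply Rabs_le_between in HT.
    apply Rabs_le. lra. }
  unfold D1, D2, D3 in Z. lra. }
pose proof (K 1 0). pose proof (K 0 1). pose proof (K 1 1). pose proof (K 1 (- 1)).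
clear K. repeat split; lra.
Qed.

(** * Superlevel sets that are convex epigraphs *)

Lemma has_grad_plus U f fx fy g gx gy :
  has_grad U f fx fy -> has_grad U g gx gy ->
  has_grad U (fun x y => f x y + g x y) (fun x y => fx x y + gx x y)
    (fun x y => fy x y + gy x y).
Proof.
intros Hf Hg x y a b s Hs.
evar_last; [exact (is_derive_plus _ _ _ _ _ (Hf x y a b s Hs) (Hg x y a b s Hs))|].
simpl. unfold plus. simpl. ring.
Qed.

Lemma has_grad_mult U f fx fy g gx gy :
  has_grad U f fx fy -> has_grad U g gx gy ->
  has_grad U (fun x y => f x y * g x y) (fun x y => fx x y * g x y + f x y * gx x y)
    (fun x y => fy x y * g x y + f x y * gy x y).
Proof.
intros Hf Hg x y a b s Hs.
evar_last; [exact (is_derive_mult _ _ _ _ _ (Hf x y a b s Hs) (Hg x y a b s Hs) Rmult_comm)|].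
simpl. unfold plus, mult. simpl. ring.
Qed.

(** Where the minimum over [0,1] is attained in the interior, the function would
    have a critical point with negative second derivative, that is a strict
    local maximum. *)
Lemma ge_endpoints_of_strict_critical_points (phi psi chi : R -> R) (c : R) :
  (forall s, 0 <= s <= 1 -> is_derive phi s (psi s)) ->
  (forall s, 0 <= s <= 1 -> is_derive psi s (chi s)) ->
  (forall s, 0 <= s <= 1 -> psi s = 0 -> chi s < 0) ->
  c <= phi 0 -> c <= phi 1 ->
  forall s, 0 <= s <= 1 -> c <= phi s.
Proof.
intros H1 H2 H3 E0 E1 s Hs.
destruct (continuity_ab_min phi 0 1) as [m [Hmin Hm]]; [lra| |].
{ intros r Hr. apply derivable_continuous_pt. exists (psi r).
  apply is_derive_Reals, H1, Hr. }
apply Rle_trans with (phi m); [|apply Hmin, Hs].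
destruct (Rle_lt_dec c (phi m)) as [|Hlt]; [assumption|exfalso].
assert (Hm' : 0 < m < 1).
{ destruct (Req_dec m 0) as [->|]; [lra|]. destruct (Req_dec m 1) as [->|]; lra. }
assert (Z : psi m = 0).
{ pose (pr := exist _ (psi m) (proj1 (is_derive_Reals _ _ _) (H1 m Hm))
     : derivable_pt phi m).
  change (psi m) with (derive_pt phi m pr).
  apply (deriv_minimum phi 0 1 m pr); [lra|lra|]. intros x Hx0 Hx1. apply Hmin. lra. }
pose proof (H3 m Hm Z) as N.
destruct (proj1 (is_derive_Reals _ _ _) (H2 m Hm) (- chi m) ltac:(lra)) as [d Hd].
pose proof (cond_pos d) as Hdp.
set (h := Rmin (d / 2) (1 - m)).
assert (Hh : 0 < h) by (apply Rmin_pos; lra).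
assert (Hh1 : h <= d / 2) by apply Rmin_l.
assert (Hh2 : h <= 1 - m) by apply Rmin_r.
destruct (MVT_cor2 phi psi m (m + h)) as [r [E Hr]]; [lra| |].
{ intros r Hr. apply is_derive_Reals, H1. lra. }
assert (Hpsi : psi r < 0).
{ specialize (Hd (r - m) ltac:(lra) ltac:(rewrite Rabs_pos_eq; lra)).
  replace (m + (r - m)) with r in Hd by ring. rewrite Z in Hd.
  apply Rabs_lt_between in Hd.
  assert (Q : (psi r - 0) / (r - m) < 0) by lra.
  replace (psi r) with ((psi r - 0) / (r - m) * (r - m)) by (field; lra). nra. }
pose proof (Hmin (m + h) ltac:(lra)). nra.
Qed.

Lemma continuity_2d_neg f x y :
  continuity_2d_pt f x y -> f x y < 0 -> locally_2d (fun u v => f u v < 0) x y.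
Proof.
intros H Hf. assert (Hp : 0 < - f x y) by lra.
generalize (H (mkposreal _ Hp)). apply locally_2d_impl, locally_2d_forall.
intros u v Huv. simpl in Huv. apply Rabs_lt_between in Huv. lra.
Qed.

Lemma has_grad_dx U f fx fy x y :
  has_grad U f fx fy -> U x y -> is_derive (fun z => f z y) x (fx x y).
Proof.
intros H Hxy. generalize (H 0 y 1 0 x).
replace (0 + x * 1) with x by ring. replace (y + x * 0) with y by ring.
intros K. specialize (K Hxy).
evar_last; [apply is_derive_ext with (2 := K)|simpl; ring].
intros t. simpl. f_equal; ring.
Qed.

Lemma has_grad_dy U f fx fy x y :
  has_grad U f fx fy -> U x y -> is_derive (fun z => f x z) y (fy x y).
Proof.
intros H Hxy. generalize (H x 0 0 1 y).
replace (0 + y * 1) with y by ring. replace (x + y * 0) with x by ring.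
intros K. specialize (K Hxy).
evar_last; [apply is_derive_ext with (2 := K)|simpl; ring].
intros t. simpl. f_equal; ring.
Qed.

(** Monotonicity in [y] makes the level set a graph.  For convexity, join two
    points of the graph by a segment of direction [(A, D)] and look at [F] along
    it.  At a critical point [D = - A * Fx / Fy], and there the second derivative
    of [F] along the segment is [A ^ 2 / Fy ^ 2] times the left-hand side of the
    last hypothesis (minus the curvature of the level set, up to a positive
    factor), hence negative.  So [F >= c] on the segment, which therefore lies
    above the graph. *)
Lemma superlevel_convex_epigraph (U : R -> R -> Prop)
    (F Fx Fy Fxx Fxy Fyx Fyy : R -> R -> R) (c : R) :
  locally_2d U 0 0 ->
  has_grad U F Fx Fy -> has_grad U Fx Fxx Fxy -> has_grad U Fy Fyx Fyy ->
  continuity_2d_pt Fx 0 0 -> continuity_2d_pt Fy 0 0 ->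
  continuity_2d_pt Fxx 0 0 -> continuity_2d_pt Fxy 0 0 ->
  continuity_2d_pt Fyx 0 0 -> continuity_2d_pt Fyy 0 0 ->
  F 0 0 = c -> 0 < Fy 0 0 ->
  Fxx 0 0 * Fy 0 0 ^ 2 - (Fxy 0 0 + Fyx 0 0) * Fx 0 0 * Fy 0 0
    + Fyy 0 0 * Fx 0 0 ^ 2 < 0 ->
  exists (delta a : R) (g : R -> R),
    delta > 0 /\ a > 0 /\
    (forall x y, - delta < x < delta -> - a < y < a -> U x y) /\
    (forall x, - delta < x < delta -> - a < g x < a) /\
    convex_on (fun x => - delta < x < delta) g /\
    (forall x y, - delta < x < delta -> - a < y < a -> (F x y > c <-> y > g x)).
Proof.
intros HU GF Gx Gy Cx Cy Cxx Cxy Cyx Cyy E0 Py PL.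
(* products instead of powers, for the continuity lemmas to apply *)
pose (L := fun x y => Fxx x y * (Fy x y * Fy x y) - (Fxy x y + Fyx x y) * Fx x y * Fy x y
    + Fyy x y * (Fx x y * Fx x y)).
assert (CL : continuity_2d_pt L 0 0).
{ unfold L. repeat first [assumption | apply continuity_2d_pt_minus | apply continuity_2d_pt_plus
    | apply continuity_2d_pt_mult]. }
assert (NL : L 0 0 < 0) by (unfold L; lra).
assert (NFy : locally_2d (fun u v => - Fy u v < 0) 0 0).
{ apply (continuity_2d_neg (fun u v => - Fy u v)); [now apply continuity_2d_pt_opp|lra]. }
pose proof (continuity_2d_neg L 0 0 CL NL) as NL'.
destruct (locally_2d_and _ _ _ _ HU (locally_2d_and _ _ _ _ NFy NL')) as [rho Hrho].
pose proof (cond_pos rho) as Hrp.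
assert (Box : forall x y, - rho < x < rho -> - rho < y < rho ->
  U x y /\ 0 < Fy x y /\ L x y < 0).
{ intros x y Hx Hy. destruct (Hrho x y) as [B1 [B2 B3]].
  - apply Rabs_def1; lra.
  - apply Rabs_def1; lra.
  - repeat split; trivial; lra. }
clear HU NFy NL' Hrho.
assert (Mono : forall x y1 y2, - rho < x < rho -> - rho < y1 -> y1 < y2 -> y2 < rho ->
  F x y1 < F x y2).
{ intros x y1 y2 Hx H1 H12 H2.
  destruct (MVT_cor2 (fun y => F x y) (fun y => Fy x y) y1 y2 H12) as [r [E Hr]].
  - intros r Hr. apply is_derive_Reals.
    apply (has_grad_dy U F Fx Fy x r GF), Box; lra.
  - destruct (Box x r Hx ltac:(lra)) as [_ [P _]]. revert E. clear - P Hr H12. nra. }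
set (a := rho / 2). assert (Ha : 0 < a < rho) by (unfold a; lra).
assert (Cont : forall y, - rho < y < rho -> continuity_pt (fun x => F x y) 0).
{ intros y Hy. apply derivable_continuous_pt. exists (Fx 0 y). apply is_derive_Reals.
  apply (has_grad_dx U F Fx Fy 0 y GF), Box; lra. }
pose proof (Mono 0 0 a ltac:(lra) ltac:(lra) ltac:(lra) ltac:(lra)) as Up.
pose proof (Mono 0 (- a) 0 ltac:(lra) ltac:(lra) ltac:(lra) ltac:(lra)) as Lo.
rewrite E0 in Up, Lo.
destruct (Cont a ltac:(lra) (F 0 a - c) ltac:(lra)) as [d1 [Hd1 C1]].
destruct (Cont (- a) ltac:(lra) (c - F 0 (- a)) ltac:(lra)) as [d2 [Hd2 C2]].
set (delta := Rmin rho (Rmin d1 d2)).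
assert (Hdelta : 0 < delta) by (repeat apply Rmin_pos; lra).
assert (Hdr : delta <= rho) by apply Rmin_l.
assert (Hdd1 : delta <= d1) by (eapply Rle_trans; [apply Rmin_r|apply Rmin_l]).
assert (Hdd2 : delta <= d2) by (eapply Rle_trans; [apply Rmin_r|apply Rmin_r]).
assert (Sides : forall x, - delta < x < delta -> F x (- a) < c < F x a).
{ intros x Hx. destruct (Req_dec x 0) as [->|Hn]; [lra|].
  assert (Hax : Rabs x < delta) by (apply Rabs_def1; lra).
  assert (K1 := C1 x). assert (K2 := C2 x). simpl in K1, K2. unfold Rdist in K1, K2.
  rewrite Rminus_0_r in K1, K2.
  assert (N : D_x no_cond 0 x) by (split; [exact I|lra]).
  specialize (K1 (conj N (Rlt_le_trans _ _ _ Hax Hdd1))).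
  specialize (K2 (conj N (Rlt_le_trans _ _ _ Hax Hdd2))).
  apply Rabs_lt_between in K1. apply Rabs_lt_between in K2. lra. }
assert (G : forall x, {y | - delta < x < delta -> - a < y < a /\ F x y = c}).
{ intros x.
  destruct (Rlt_dec (- delta) x) as [X1|X1]; [|exists 0; intros H; exfalso; lra].
  destruct (Rlt_dec x delta) as [X2|X2]; [|exists 0; intros H; exfalso; lra].
  destruct (Sides x (conj X1 X2)) as [S1 S2].
  destruct (Ranalysis5.IVT_interv (fun y => F x y - c) (- a) a) as [y [Hy E]]; [|lra|lra|lra|].
  - intros y Hy. apply derivable_continuous_pt. exists (Fy x y). apply is_derive_Reals.
    assert (D := has_grad_dy U F Fx Fy x y GF ltac:(apply Box; lra)).
    auto_derive; [now exists (Fy x y)|]. rewrite_Derive D. ring.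
  - exists y. intros _.
    destruct (Req_dec y a) as [->|]; [lra|].
    destruct (Req_dec y (- a)) as [->|]; lra. }
assert (exists g, forall x, - delta < x < delta -> - a < g x < a /\ F x (g x) = c)
  as [g Gs].
{ exists (fun x => proj1_sig (G x)). intros x. exact (proj2_sig (G x)). }
exists delta, a, g. clear G.
assert (Graph : forall x y, - delta < x < delta -> - a < y < a ->
  (F x y > c <-> y > g x)).
{ intros x y Hx Hy. destruct (Gs x Hx) as [Hg Eg]. split; intros H.
  - destruct (Rtotal_order y (g x)) as [T|[->|T]]; [|lra|lra].
    pose proof (Mono x y (g x) ltac:(lra) ltac:(lra) T ltac:(lra)). lra.
  - pose proof (Mono x (g x) y ltac:(lra) ltac:(lra) ltac:(lra) ltac:(lra)). lra. }
split; [lra|]. split; [lra|]. split; [|split; [|split; [|exact Graph]]].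
{ intros x y Hx Hy. apply Box; lra. }
{ intros x Hx. now apply Gs. }
intros x1 x2 l H1 H2 Hl.
destruct (Req_dec x1 x2) as [->|Hne].
{ replace (l * x2 + (1 - l) * x2) with x2 by ring. lra. }
destruct (Gs x1 H1) as [B1 E1]. destruct (Gs x2 H2) as [B2 E2].
(* chords of the graph stay in the box *)
assert (Conv : forall s, 0 <= s <= 1 ->
  - delta < x2 + s * (x1 - x2) < delta /\ - a < g x2 + s * (g x1 - g x2) < a).
{ assert (Comb : forall m p q s, - m < p < m -> - m < q < m -> 0 <= s <= 1 ->
    - m < q + s * (p - q) < m).
  { intros m p q s Hp Hq Hs. destruct (Rle_lt_dec p q).
    - assert (0 <= s * (q - p) <= q - p) by nra. lra.
    - assert (0 <= s * (p - q) <= p - q) by nra. lra. }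
  intros s Hs. split; now apply Comb. }
assert (Hx : - delta < l * x1 + (1 - l) * x2 < delta).
{ replace (l * x1 + (1 - l) * x2) with (x2 + l * (x1 - x2)) by ring. now apply Conv. }
destruct (Gs _ Hx) as [B E].
assert (Hy : - a < l * g x1 + (1 - l) * g x2 < a).
{ replace (l * g x1 + (1 - l) * g x2) with (g x2 + l * (g x1 - g x2)) by ring.
  now apply Conv. }
apply Rnot_lt_le. intros Hlt.
assert (Hlow : F (l * x1 + (1 - l) * x2) (l * g x1 + (1 - l) * g x2) < c).
{ rewrite <- E. apply Mono; lra. }
enough (c <= F (l * x1 + (1 - l) * x2) (l * g x1 + (1 - l) * g x2)) by lra.
replace (l * x1 + (1 - l) * x2) with (x2 + l * (x1 - x2)) by ring.
replace (l * g x1 + (1 - l) * g x2) with (g x2 + l * (g x1 - g x2)) by ring.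
set (A := x1 - x2) in *. set (D := g x1 - g x2) in *.
apply (ge_endpoints_of_strict_critical_points
  (fun s => F (x2 + s * A) (g x2 + s * D))
  (fun s => Fx (x2 + s * A) (g x2 + s * D) * A + Fy (x2 + s * A) (g x2 + s * D) * D)
  (fun s => (Fxx (x2 + s * A) (g x2 + s * D) * A + Fxy (x2 + s * A) (g x2 + s * D) * D) * A
          + (Fyx (x2 + s * A) (g x2 + s * D) * A + Fyy (x2 + s * A) (g x2 + s * D) * D) * D)
  c); trivial.
- intros s Hs. destruct (Conv s Hs). apply GF, Box; lra.
- intros s Hs. destruct (Conv s Hs).
  apply is_derive_lincomb; [apply Gx, Box|apply Gy, Box]; lra.
- intros s Hs. destruct (Conv s Hs) as [Q1 Q2].
  destruct (Box (x2 + s * A) (g x2 + s * D) ltac:(lra) ltac:(lra)) as [_ [P N]].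
  unfold L in N.
  generalize dependent (Fx (x2 + s * A) (g x2 + s * D)).
  generalize dependent (Fy (x2 + s * A) (g x2 + s * D)).
  generalize dependent (Fxx (x2 + s * A) (g x2 + s * D)).
  generalize dependent (Fxy (x2 + s * A) (g x2 + s * D)).
  generalize dependent (Fyx (x2 + s * A) (g x2 + s * D)).
  generalize dependent (Fyy (x2 + s * A) (g x2 + s * D)).
  intros fyy fyx fxy fxx fy P fx N Z.
  assert (HA : A <> 0) by (unfold A; lra).
  assert (HA2 : 0 < A * A) by nra.
  apply Rmult_lt_reg_l with (fy * fy); [nra|]. rewrite Rmult_0_r.
  replace (fy * fy * ((fxx * A + fxy * D) * A + (fyx * A + fyy * D) * D))
    with (fxx * (fy * fy) * (A * A) + (fxy + fyx) * A * fy * (fy * D)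
          + fyy * (fy * D) * (fy * D)) by ring.
  replace (fy * D) with (- (fx * A)) by lra.
  replace (fxx * (fy * fy) * (A * A) + (fxy + fyx) * A * fy * - (fx * A) +
    fyy * - (fx * A) * - (fx * A))
    with (A * A * (fxx * (fy * fy) - (fxy + fyx) * fx * fy + fyy * (fx * fx))) by ring.
  rewrite <- (Rmult_0_r (A * A)). now apply Rmult_lt_compat_l.
- replace (x2 + 0 * A) with x2 by ring. replace (g x2 + 0 * D) with (g x2) by ring. lra.
- replace (x2 + 1 * A) with x1 by (unfold A; ring).
  replace (g x2 + 1 * D) with (g x1) by (unfold D; ring). lra.
Qed.

Lemma grad_norm_gt_1 f x y :
  grad_norm f x y > 1 <-> dx f x y * dx f x y + dy f x y * dy f x y > 1.
Proof.
unfold grad_norm, norm2.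
replace (dx f x y ^ 2 + dy f x y ^ 2)
  with (dx f x y * dx f x y + dy f x y * dy f x y) by ring.
set (v := _ + _).
split; intros H.
- apply Rnot_le_gt. intros Hv. apply sqrt_le_1_alt in Hv. rewrite sqrt_1 in Hv. lra.
- rewrite <- sqrt_1. apply sqrt_lt_1_alt. lra.
Qed.

(** Here [F] is the square of the gradient norm.  At the origin
    [Fx = 0], so in the convexity criterion only the term [Fxx * Fy ^ 2] remains,
    and [Fxx] has the sign of the third derivative of [f] in [x]. *)
Lemma superlevel_of_jet (Omega : R * R -> Prop) (f : R -> R -> R) :
  open Omega -> Omega (0, 0) ->
  (forall x y, Omega (x, y) -> ex_diff_n f 3 x y) ->
  dx f 0 0 = sqrt 2 / 2 -> dy f 0 0 = sqrt 2 / 2 ->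
  dx (dx f) 0 0 = 0 -> dx (dy f) 0 0 = 0 -> 0 < dy (dy f) 0 0 ->
  dx (dx (dx f)) 0 0 < 0 -> dx (dx (dy f)) 0 0 = 0 ->
  exists (delta a : R) (g : R -> R),
     delta > 0 /\ a > 0 /\
     (forall x y, - delta < x < delta -> - a < y < a -> Omega (x, y)) /\
     (forall x, - delta < x < delta -> - a < g x < a) /\
     convex_on (fun x => - delta < x < delta) g /\
     (forall x y, - delta < x < delta -> - a < y < a ->
        (grad_norm f x y > 1 <-> y > g x)).
Proof.
intros Ho H0 Hf Ep Eq Epx Eqx Hqy Hpxx Eqxx.
set (U := fun x y => Omega (x, y)).
assert (HU : locally_2d U 0 0).
{ apply locally_2d_locally. generalize (Ho (0, 0) H0). apply filter_imp. now intros [u v]. }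
assert (Loc := fun x y => open_ex_diff_n Omega f 3 x y Ho Hf).
assert (G : forall h, (forall x y, ex_diff_n f 3 x y -> ex_diff_n h 1 x y) ->
  has_grad U h (dx h) (dy h)).
{ intros h Hh. apply has_grad_C1. intros x y Hxy.
  exact (locally_2d_ex_diff_n_le f h 3 1 x y Hh (Loc x y Hxy)). }
pose proof ex_diff_n_dx as Jx. pose proof ex_diff_n_dy as Jy.
assert (J1 : forall h x y, ex_diff_n h 2 x y -> ex_diff_n h 1 x y)
  by (intros h x y; apply ex_diff_n_m; auto).
assert (Gp := G (dx f) ltac:(auto)). assert (Gq := G (dy f) ltac:(auto)).
assert (Gpx := G (dx (dx f)) ltac:(auto)). assert (Gpy := G (dy (dx f)) ltac:(auto)).
assert (Gqx := G (dx (dy f)) ltac:(auto)). assert (Gqy := G (dy (dy f)) ltac:(auto)).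
assert (Jet := Hf 0 0 H0).
assert (S2 : dy (dx f) 0 0 = 0).
{ transitivity (dx (dy f) 0 0); [symmetry; apply dx_dy_comm|exact Eqx].
  apply (locally_2d_ex_diff_n_le f f 3 2); [intros u v; apply ex_diff_n_m; auto|].
  now apply Loc. }
assert (Hw : 0 < sqrt 2) by (apply sqrt_lt_R0; lra).
pose proof (sqrt_sqrt 2 ltac:(lra)) as Hw2.
destruct (superlevel_convex_epigraph U
  (fun x y => dx f x y * dx f x y + dy f x y * dy f x y) _ _ _ _ _ _ 1 HU
  (has_grad_plus _ _ _ _ _ _ _ (has_grad_mult _ _ _ _ _ _ _ Gp Gp)
                                (has_grad_mult _ _ _ _ _ _ _ Gq Gq))
  (has_grad_plus _ _ _ _ _ _ _
    (has_grad_plus _ _ _ _ _ _ _ (has_grad_mult _ _ _ _ _ _ _ Gpx Gp)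
                                  (has_grad_mult _ _ _ _ _ _ _ Gp Gpx))
    (has_grad_plus _ _ _ _ _ _ _ (has_grad_mult _ _ _ _ _ _ _ Gqx Gq)
                                  (has_grad_mult _ _ _ _ _ _ _ Gq Gqx)))
  (has_grad_plus _ _ _ _ _ _ _
    (has_grad_plus _ _ _ _ _ _ _ (has_grad_mult _ _ _ _ _ _ _ Gpy Gp)
                                  (has_grad_mult _ _ _ _ _ _ _ Gp Gpy))
    (has_grad_plus _ _ _ _ _ _ _ (has_grad_mult _ _ _ _ _ _ _ Gqy Gq)
                                  (has_grad_mult _ _ _ _ _ _ _ Gq Gqy))))
  as (delta & a & g & H).
1-6: repeat first [apply continuity_2d_pt_plus | apply continuity_2d_pt_mult
     | eapply ex_diff_n_continuity; eauto].
- rewrite Ep, Eq. lra.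
- rewrite Ep, Eq, S2. nra.
- rewrite Ep, Eq, S2, Epx, Eqx, Eqxx. ring_simplify.
  assert (0 < (sqrt 2 / 2) ^ 3 * dy (dy f) 0 0 ^ 2).
  { apply Rmult_lt_0_compat; apply pow_lt; lra. }
  nra.
- exists delta, a, g. destruct H as (H1 & H2 & H3 & H4 & H5 & H6).
  repeat split; try lra; trivial; try (now apply H4).
  + intros K. apply H6; trivial. now apply grad_norm_gt_1.
  + intros K. apply grad_norm_gt_1. now apply H6.
Qed.

(** * The divergence of the flux *)

Lemma is_derive_norm2 (p q : R -> R) (t p' q' : R) :
  is_derive p t p' -> is_derive q t q' -> 0 < norm2 (p t) (q t) ->
  is_derive (fun s => norm2 (p s) (q s)) t ((p t * p' + q t * q') / norm2 (p t) (q t)).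
Proof.
intros Hp Hq HN. unfold norm2 in *.
assert (H0 : 0 < p t ^ 2 + q t ^ 2).
{ apply Rnot_le_lt. intros H. rewrite sqrt_neg_0 in HN; lra. }
auto_derive.
- repeat split; [now exists p'|now exists q'|]. simpl in H0. lra.
- rewrite_Derive Hp. rewrite_Derive Hq. simpl pow in *. field.
  intros E. rewrite E in HN. lra.
Qed.

Lemma smooth_is_derive phi n x :
  smooth phi -> is_derive (Derive_n phi n) x (Derive_n phi (S n) x).
Proof. intros H. apply Derive_correct, (H (S n) x). Qed.

Lemma is_derive_flux (h N r : R -> R) (t h' N' r' : R) :
  is_derive h (N t) h' -> is_derive N t N' -> is_derive r t r' -> N t <> 0 ->
  is_derive (fun s => h (N s) * r s / N s) t
    (h' * N' * r t / N t + h (N t) * (r' / N t - r t * N' / N t ^ 2)).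
Proof.
intros Hh HN Hr H0.
auto_derive.
- repeat split; solve [exact H0 | eexists; eassumption].
- rewrite_Derive Hh. rewrite_Derive HN. rewrite_Derive Hr. field. exact H0.
Qed.

(** The divergence of [phi'(|P|) P / |P|] as a function of the value [(p, q)] of
    the vector field [P] and of the entries of its Jacobian matrix; [S] is [N]
    times the value of the Jacobian form on the unit vector [P / N]. *)
Definition flux_divergence (phi : R -> R) (p q px qx py qy : R) : R :=
  let N := norm2 p q in
  let S := (p ^ 2 * px + p * q * (qx + py) + q ^ 2 * qy) / N in
  Derive_n phi 2 N * S / N + Derive phi N * ((px + qy) / N - S / N ^ 2).

Lemma div_flux_expand phi f x y px qx py qy :
  smooth phi ->
  is_derive (fun z => dx f z y) x px -> is_derive (fun z => dy f z y) x qx ->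
  is_derive (fun z => dx f x z) y py -> is_derive (fun z => dy f x z) y qy ->
  0 < grad_norm f x y ->
  div_flux phi f x y = flux_divergence phi (dx f x y) (dy f x y) px qx py qy.
Proof.
intros Hphi Hpx Hqx Hpy Hqy HN. unfold grad_norm in HN.
assert (Hn : norm2 (dx f x y) (dy f x y) <> 0) by lra.
assert (H2 := smooth_is_derive phi 1 (norm2 (dx f x y) (dy f x y)) Hphi).
pose proof (is_derive_norm2 _ _ _ _ _ Hpx Hqx HN) as Nx.
pose proof (is_derive_norm2 _ _ _ _ _ Hpy Hqy HN) as Ny.
unfold div_flux.
replace (dx (fun a b => flux1 phi (dx f a b) (dy f a b)) x y) with
  (Derive_n phi 2 (norm2 (dx f x y) (dy f x y))
     * ((dx f x y * px + dy f x y * qx) / norm2 (dx f x y) (dy f x y)) * dx f x y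
     / norm2 (dx f x y) (dy f x y)
   + Derive phi (norm2 (dx f x y) (dy f x y)) * (px / norm2 (dx f x y) (dy f x y)
     - dx f x y * ((dx f x y * px + dy f x y * qx) / norm2 (dx f x y) (dy f x y))
       / norm2 (dx f x y) (dy f x y) ^ 2)).
2: { symmetry. apply is_derive_unique.
  exact (is_derive_flux (Derive phi) (fun z => norm2 (dx f z y) (dy f z y))
    (fun z => dx f z y) x _ _ _ H2 Nx Hpx Hn). }
replace (dy (fun a b => flux2 phi (dx f a b) (dy f a b)) x y) with
  (Derive_n phi 2 (norm2 (dx f x y) (dy f x y))
     * ((dx f x y * py + dy f x y * qy) / norm2 (dx f x y) (dy f x y)) * dy f x y
     / norm2 (dx f x y) (dy f x y)
   + Derive phi (norm2 (dx f x y) (dy f x y)) * (qy / norm2 (dx f x y) (dy f x y)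
     - dy f x y * ((dx f x y * py + dy f x y * qy) / norm2 (dx f x y) (dy f x y))
       / norm2 (dx f x y) (dy f x y) ^ 2)).
2: { symmetry. apply is_derive_unique.
  exact (is_derive_flux (Derive phi) (fun z => norm2 (dx f x z) (dy f x z))
    (fun z => dy f x z) y _ _ _ H2 Ny Hqy Hn). }
unfold flux_divergence. cbv zeta. field. exact Hn.
Qed.

Lemma norm2_unit_diagonal : norm2 (sqrt 2 / 2) (sqrt 2 / 2) = 1.
Proof.
unfold norm2. replace ((sqrt 2 / 2) ^ 2 + (sqrt 2 / 2) ^ 2) with 1; [apply sqrt_1|].
pose proof (sqrt_sqrt 2 ltac:(lra)). nra.
Qed.

(** At [t] one has [N = 1], [S = 1] and trace 2.  Since [phi''(1) = 0], the
    derivative of the first term is [phi'''(1) * N'] and the factor [phi'(N)] of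
    the second one is stationary; the derivatives of [1 / N] and [1 / N ^ 2] in
    the second term cancel, because the trace is twice [S]. *)
Lemma is_derive_flux_divergence phi (p q px qx py qy : R -> R) (t p' q' px' qx' py' qy' : R) :
  smooth phi -> Derive_n phi 2 1 = 0 ->
  is_derive p t p' -> is_derive q t q' -> is_derive px t px' ->
  is_derive qx t qx' -> is_derive py t py' -> is_derive qy t qy' ->
  p t = sqrt 2 / 2 -> q t = sqrt 2 / 2 ->
  px t = 0 -> qx t = 0 -> py t = 0 -> qy t = 2 ->
  is_derive (fun s => flux_divergence phi (p s) (q s) (px s) (qx s) (py s) (qy s)) t
    (Derive_n phi 3 1 * (sqrt 2 / 2 * (p' + q'))
     + Derive phi 1 * ((px' + qy' - qx' - py') / 2 + sqrt 2 / 2 * (p' - 3 * q'))).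
Proof.
intros Hphi H0 Dp Dq Dpx Dqx Dpy Dqy Ep Eq Epx Eqx Epy Eqy.
set (N := fun s => norm2 (p s) (q s)).
assert (EN : N t = 1) by (unfold N; rewrite Ep, Eq; apply norm2_unit_diagonal).
assert (DN : is_derive N t (sqrt 2 / 2 * (p' + q'))).
{ evar_last; [apply (is_derive_norm2 p q t p' q' Dp Dq)|].
  - change (norm2 (p t) (q t)) with (N t). lra.
  - change (norm2 (p t) (q t)) with (N t). rewrite EN, Ep, Eq. field. }
set (S := fun s => (p s ^ 2 * px s + p s * q s * (qx s + py s) + q s ^ 2 * qy s) / N s).
pose proof (sqrt_sqrt 2 ltac:(lra)) as E2.
assert (ES : S t = 1).
{ unfold S. rewrite EN, Ep, Eq, Epx, Eqx, Epy, Eqy. nra. }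
assert (DS : is_derive S t ((px' + qx' + py' + qy') / 2 + sqrt 2 / 2 * (3 * q' - p'))).
{ unfold S. auto_derive.
  - repeat split; try (eexists; eassumption). rewrite EN. lra.
  - rewrite_Derive Dp. rewrite_Derive Dq. rewrite_Derive Dpx. rewrite_Derive Dqx.
    rewrite_Derive Dpy. rewrite_Derive Dqy. rewrite_Derive DN.
    rewrite EN, Ep, Eq, Epx, Eqx, Epy, Eqy.
    set (w := sqrt 2) in *.
    assert (E3 : w ^ 3 = 2 * w) by (simpl; rewrite Rmult_1_r, E2; ring).
    assert (E2' : w ^ 2 = 2) by (simpl; rewrite Rmult_1_r, E2; ring).
    field_simplify. rewrite E3, E2'. field. }
assert (H2 := smooth_is_derive phi 1 1 Hphi).
assert (H3 := smooth_is_derive phi 2 1 Hphi).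
change (Derive_n phi 1) with (Derive phi) in H2.
rewrite <- EN in H2, H3.
apply (is_derive_ext (fun s => Derive_n phi 2 (N s) * S s / N s
   + Derive phi (N s) * ((px s + qy s) / N s - S s / N s ^ 2))); [reflexivity|].
rewrite <- EN in H0 |- *.
generalize dependent (Derive_n phi 3 (N t)). intros d H3.
generalize dependent (Derive_n phi 2). intros phi2 H0 H2 H3.
generalize dependent (Derive phi). intros phi1 H2.
clearbody N S.
auto_derive.
- repeat split; try (eexists; eassumption); simpl; rewrite EN; lra.
- rewrite_Derive Dpx. rewrite_Derive Dqy. rewrite_Derive H2. rewrite_Derive H3.
  rewrite_Derive DN. rewrite_Derive DS.
  rewrite H0, ES, Epx, Eqy, EN. field.
Qed.

Lemma div_flux_ext_loc phi f g x y :
  locally_2d (fun u v => f u v = g u v) x y -> div_flux phi f x y = div_flux phi g x y.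
Proof.
intros H.
assert (Hx : locally_2d (fun u v => dx f u v = dx g u v) x y).
{ generalize (locally_2d_locally_2d _ _ _ H). apply locally_2d_impl, locally_2d_forall.
  intros u v K. apply Derive_ext_loc. exact (locally_2d_1d_const_y _ _ _ K). }
assert (Hy : locally_2d (fun u v => dy f u v = dy g u v) x y).
{ generalize (locally_2d_locally_2d _ _ _ H). apply locally_2d_impl, locally_2d_forall.
  intros u v K. apply Derive_ext_loc. exact (locally_2d_1d_const_x _ _ _ K). }
pose proof (locally_2d_and _ _ _ _ Hx Hy) as Hxy.
unfold div_flux. f_equal; apply Derive_ext_loc.
- generalize (locally_2d_1d_const_y _ _ _ Hxy). apply filter_imp. intros z [-> ->]. reflexivity.
- generalize (locally_2d_1d_const_x _ _ _ Hxy). apply filter_imp. intros z [-> ->]. reflexivity.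
Qed.

(** The coefficient [h2] enters only the second component, linearly and with a
    positive factor when [phi'(1) > 0]. *)
Lemma div_flux_gradient_at_jet phi f h1 h2 :
  smooth phi -> Derive_n phi 2 1 = 0 -> locally_2d (ex_diff_n f 3) 0 0 ->
  (dx f 0 0 = sqrt 2 / 2 /\ dy f 0 0 = sqrt 2 / 2) ->
  (dx (dx f) 0 0 = 0 /\ dx (dy f) 0 0 = 0 /\ dy (dy f) 0 0 = 2) ->
  (dx (dx (dx f)) 0 0 = 6 * h1 /\ dx (dx (dy f)) 0 0 = 0 /\
   dx (dy (dy f)) 0 0 = 0 /\ dy (dy (dy f)) 0 0 = 6 * h2) ->
  is_derive (fun z => div_flux phi f z 0) 0 (3 * Derive phi 1 * h1) /\
  is_derive (fun z => div_flux phi f 0 z) 0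
    (3 * Derive phi 1 * h2 + sqrt 2 * (Derive_n phi 3 1 - 3 * Derive phi 1)).
Proof.
intros Hphi Hphi2 Hf [Ep Eq] (Epx & Eqx & Eqy) (E30 & E21 & E12 & E03).
destruct (third_partials_comm f 0 0 Hf) as [[T1 T2] [T3 T4]].
assert (S2 : dy (dx f) 0 0 = 0).
{ transitivity (dx (dy f) 0 0); [symmetry; apply dx_dy_comm|exact Eqx].
  apply (locally_2d_ex_diff_n_le f f 3 2); [intros u v; apply ex_diff_n_m; auto|exact Hf]. }
pose proof ex_diff_n_dx as Jx. pose proof ex_diff_n_dy as Jy.
assert (J1 : forall h x y, ex_diff_n h 2 x y -> ex_diff_n h 1 x y)
  by (intros h x y; apply ex_diff_n_m; auto).
assert (Dx : forall h x y, ex_diff_n h 1 x y -> is_derive (fun z => h z y) x (dx h x y)).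
{ intros h x y Hh. apply Derive_correct. simpl in Hh. tauto. }
assert (Dy : forall h x y, ex_diff_n h 1 x y -> is_derive (fun z => h x z) y (dy h x y)).
{ intros h x y Hh. apply Derive_correct. simpl in Hh. tauto. }
assert (Hf0 := locally_2d_singleton _ _ _ Hf).
assert (Ex : locally_2d (fun x y => div_flux phi f x y =
  flux_divergence phi (dx f x y) (dy f x y) (dx (dx f) x y) (dx (dy f) x y)
    (dy (dx f) x y) (dy (dy f) x y)) 0 0).
{ assert (Np : locally_2d (fun x y => - dx f x y < 0) 0 0).
  { apply (continuity_2d_neg (fun x y => - dx f x y)).
    - apply continuity_2d_pt_opp. eapply ex_diff_n_continuity; eauto.
    - rewrite Ep. pose proof (sqrt_lt_R0 2). lra. }
  generalize (locally_2d_and _ _ _ _ Hf Np).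
  apply locally_2d_impl, locally_2d_forall. intros x y [Hxy Hp].
  apply div_flux_expand; auto.
  apply sqrt_lt_R0. nra. }
split.
- apply is_derive_ext_loc with (fun z => flux_divergence phi (dx f z 0) (dy f z 0)
    (dx (dx f) z 0) (dx (dy f) z 0) (dy (dx f) z 0) (dy (dy f) z 0)).
  { generalize (locally_2d_1d_const_y _ _ _ Ex). apply filter_imp. now intros z ->. }
  evar_last.
  { apply (is_derive_flux_divergence phi (fun z => dx f z 0) (fun z => dy f z 0)
    (fun z => dx (dx f) z 0) (fun z => dx (dy f) z 0)
    (fun z => dy (dx f) z 0) (fun z => dy (dy f) z 0)); trivial; apply Dx; auto. }
  rewrite Epx, Eqx, T1, E30, E21, E12. field.
- apply is_derive_ext_loc with (fun z => flux_divergence phi (dx f 0 z) (dy f 0 z)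
    (dx (dx f) 0 z) (dx (dy f) 0 z) (dy (dx f) 0 z) (dy (dy f) 0 z)).
  { generalize (locally_2d_1d_const_x _ _ _ Ex). apply filter_imp. now intros z ->. }
  evar_last.
  { apply (is_derive_flux_divergence phi (fun z => dx f 0 z) (fun z => dy f 0 z)
    (fun z => dx (dx f) 0 z) (fun z => dx (dy f) 0 z)
    (fun z => dy (dx f) 0 z) (fun z => dy (dy f) 0 z)); trivial; apply Dy; auto. }
  rewrite S2, Eqy, T2, T3, T4, E21, E12, E03. field.
Qed.

(** * One-sided time derivatives at the initial time *)

Lemma is_derive_within_eps (D : R -> Prop) f t l :
  is_derive_within D f t l ->
  forall eps, 0 < eps -> exists d, 0 < d /\ forall s, D s -> s <> t -> Rabs (s - t) < d ->
    Rabs ((f s - f t) / (s - t) - l) < eps.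
Proof.
intros H eps He.
destruct (proj1 (filterlim_locally _ _) H (mkposreal eps He)) as [d Hd].
exists d. split; [apply cond_pos|]. intros s Ds Hs Hst.
exact (Hd s Hst Hs Ds).
Qed.

Lemma is_derive_within_right (T : R) f l :
  0 < T -> is_derive_within (time_interval T) f 0 l ->
  forall eps, 0 < eps -> exists d, 0 < d <= T /\ forall s, 0 < s < d ->
    Rabs ((f s - f 0) / s - l) < eps.
Proof.
intros HT H eps He.
destruct (is_derive_within_eps _ _ _ _ H eps He) as [d [Hd B]].
exists (Rmin d T).
pose proof (Rmin_l d T). pose proof (Rmin_r d T).
split; [split; [now apply Rmin_pos|lra]|]. intros s Hs.
specialize (B s). rewrite Rminus_0_r in B. apply B.
- split; lra.
- lra.
- rewrite Rabs_pos_eq; lra.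
Qed.

Lemma is_derive_within_right_unique (T : R) f l1 l2 :
  0 < T -> is_derive_within (time_interval T) f 0 l1 ->
  is_derive_within (time_interval T) f 0 l2 -> l1 = l2.
Proof.
intros HT H1 H2. apply cond_eq. intros eps He.
destruct (is_derive_within_right T f l1 HT H1 (eps / 2) ltac:(lra)) as [d1 [Hd1 B1]].
destruct (is_derive_within_right T f l2 HT H2 (eps / 2) ltac:(lra)) as [d2 [Hd2 B2]].
set (s := Rmin d1 d2 / 2).
assert (Hs : 0 < s) by (apply Rdiv_lt_0_compat; [apply Rmin_pos|]; lra).
assert (s < d1) by (pose proof (Rmin_l d1 d2); unfold s in *; lra).
assert (s < d2) by (pose proof (Rmin_r d1 d2); unfold s in *; lra).
specialize (B1 s ltac:(lra)). specialize (B2 s ltac:(lra)).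
apply Rabs_lt_between in B1. apply Rabs_lt_between in B2. apply Rabs_def1; lra.
Qed.

Lemma is_derive_within_interior (T : R) f t l :
  0 < t < T -> is_derive_within (time_interval T) f t l -> is_derive f t l.
Proof.
intros Ht H. apply is_derive_Reals. intros eps He.
destruct (is_derive_within_eps _ _ _ _ H eps He) as [d [Hd B]].
assert (Hm : 0 < Rmin d (Rmin t (T - t))) by (repeat apply Rmin_pos; lra).
exists (mkposreal _ Hm). simpl. intros h Hh0 Hh.
pose proof (Rmin_l d (Rmin t (T - t))). pose proof (Rmin_r d (Rmin t (T - t))).
pose proof (Rmin_l t (T - t)). pose proof (Rmin_r t (T - t)).
specialize (B (t + h)). replace (t + h - t) with h in B by ring.
apply Rabs_lt_between in Hh as Hh'.
apply B; [split|..]; lra.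
Qed.

Lemma MVT_time_interval (T : R) f df t :
  0 < t < T ->
  (forall s, time_interval T s -> is_derive_within (time_interval T) f s (df s)) ->
  exists r, 0 <= r <= t /\ f t - f 0 = df r * t.
Proof.
intros Ht H.
(* the values of f at negative times are replaced by f 0, which makes it
   continuous at 0 on both sides *)
pose (g := fun s => f (Rmax 0 s)).
assert (Eg : forall s, 0 <= s -> g s = f s) by (intros s Hs; unfold g; now rewrite Rmax_right).
assert (Dg : forall s, 0 < s <= t -> is_derive g s (df s)).
{ intros s Hs. apply is_derive_ext_loc with f.
  - exists (mkposreal s (proj1 Hs)). intros r Hr.
    apply Rabs_lt_between in Hr. simpl in Hr. unfold minus, plus, opp in Hr. simpl in Hr.
    symmetry. apply Eg. lra.
  - apply (is_derive_within_interior T); [lra|]. apply H. split; lra. }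
destruct (MVT_gen g 0 t df) as [r [Hr E]].
- rewrite Rmin_left, Rmax_right by lra. intros s Hs. apply Dg. lra.
- rewrite Rmin_left, Rmax_right by lra. intros s Hs.
  destruct (Req_dec s 0) as [->|Hn].
  + (* near 0 the difference quotient is at most K in absolute value *)
    intros eps He.
    destruct (is_derive_within_right T f (df 0) ltac:(lra) (H 0 ltac:(split; lra)) 1 Rlt_0_1)
      as [d [Hd B]].
    set (K := Rabs (df 0) + 1).
    pose proof (Rabs_pos (df 0)) as HK.
    assert (HK1 : 0 < K) by (unfold K; lra).
    exists (Rmin d (eps / K)). split.
    { apply Rmin_pos; [lra|]. apply Rdiv_lt_0_compat; lra. }
    simpl. unfold Rdist. intros x [_ Hx]. rewrite Rminus_0_r in Hx.
    unfold g. rewrite (Rmax_right 0 0) by lra.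
    destruct (Rle_lt_dec x 0) as [Hx0|Hx0].
    { rewrite Rmax_left, Rminus_diag, Rabs_R0; lra. }
    rewrite Rmax_right by lra. rewrite Rabs_pos_eq in Hx by lra.
    pose proof (Rmin_l d (eps / K)). pose proof (Rmin_r d (eps / K)).
    specialize (B x ltac:(lra)).
    replace (f x - f 0) with ((f x - f 0) / x * x) by (field; lra).
    rewrite Rabs_mult, (Rabs_pos_eq x) by lra.
    assert (Rabs ((f x - f 0) / x) <= K).
    { replace ((f x - f 0) / x) with (((f x - f 0) / x - df 0) + df 0) by ring.
      eapply Rle_trans; [apply Rabs_triang|]. unfold K. lra. }
    apply Rle_lt_trans with (K * x); [apply Rmult_le_compat_r; lra|].
    replace eps with (K * (eps / K)) by (field; lra).
    apply Rmult_lt_compat_l; lra.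
  + apply derivable_continuous_pt. exists (df s). apply is_derive_Reals, Dg. lra.
- rewrite Rmin_left, Rmax_right in Hr by lra.
  exists r. split; [exact Hr|]. rewrite !Eg in E by lra. lra.
Qed.

(** Equality of mixed derivatives on the boundary [t = 0], where only one-sided
    derivatives in time exist: the second difference
    [v h t - v 0 t - v h 0 + v 0 0] is [h * t] times a value of [vtx] at a nearby
    point, by the mean value theorem in [t] and then in [z]; it remains to divide
    by [h] and to let [h] tend to 0. *)
Lemma space_derivative_time_expansion (T r : R) (v vt vtx : R -> R -> R) (vx : R -> R) :
  0 < T -> 0 < r ->
  (forall s, time_interval T s -> is_derive (fun z => v z s) 0 (vx s)) ->
  (forall z s, Rabs z < r -> time_interval T s ->
     is_derive_within (time_interval T) (fun s => v z s) s (vt z s)) ->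
  (forall z s, Rabs z < r -> time_interval T s ->
     is_derive (fun z => vt z s) z (vtx z s)) ->
  (forall eps, 0 < eps -> exists d, 0 < d /\ forall z s, Rabs z < d -> 0 <= s < d ->
     Rabs (vtx z s - vtx 0 0) < eps) ->
  forall eps, 0 < eps -> exists d, 0 < d <= T /\ forall t, 0 < t < d ->
    Rabs (vx t - vx 0 - vtx 0 0 * t) <= eps * t.
Proof.
intros HT Hr Hx Ht Htx Hc eps He.
destruct (Hc eps He) as [d [Hd B]].
exists (Rmin d T).
pose proof (Rmin_l d T). pose proof (Rmin_r d T).
split; [split; [now apply Rmin_pos|lra]|]. intros t Hts.
apply le_epsilon. intros eta Heta.
destruct (proj1 (is_derive_Reals _ _ _) (Hx t ltac:(split; lra)) (eta / 2) ltac:(lra))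
  as [d1 B1].
destruct (proj1 (is_derive_Reals _ _ _) (Hx 0 ltac:(split; lra)) (eta / 2) ltac:(lra))
  as [d2 B2].
set (m := Rmin (Rmin d r) (Rmin d1 d2)).
assert (Hm : 0 < m).
{ repeat apply Rmin_pos; trivial; apply cond_pos. }
assert (Hm1 : m <= d) by (eapply Rle_trans; [apply Rmin_l|apply Rmin_l]).
assert (Hm2 : m <= r) by (eapply Rle_trans; [apply Rmin_l|apply Rmin_r]).
assert (Hm3 : m <= d1) by (eapply Rle_trans; [apply Rmin_r|apply Rmin_l]).
assert (Hm4 : m <= d2) by (eapply Rle_trans; [apply Rmin_r|apply Rmin_r]).
set (h := m / 2). assert (Hh : 0 < h < m) by (unfold h; lra).
specialize (B1 h ltac:(lra) ltac:(rewrite Rabs_pos_eq; lra)).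
specialize (B2 h ltac:(lra) ltac:(rewrite Rabs_pos_eq; lra)).
rewrite Rplus_0_l in B1, B2.
destruct (MVT_time_interval T (fun s => v h s * 1 + v 0 s * (- 1))
  (fun s => vt h s * 1 + vt 0 s * (- 1)) t) as [tau [Htau E]]; [lra| |].
{ intros s Hs.
  assert (D1 := Ht h s ltac:(rewrite Rabs_pos_eq; lra) Hs).
  assert (D2 := Ht 0 s ltac:(rewrite Rabs_R0; lra) Hs).
  unfold is_derive_within in *.
  apply filterlim_ext with (fun q => plus ((v h q - v h s) / (q - s))
     (scal (- 1) ((v 0 q - v 0 s) / (q - s)))).
  { intros q. unfold plus, scal, mult. simpl. unfold mult. simpl. unfold Rdiv. ring. }
  replace (vt h s * 1 + vt 0 s * -1) with (plus (vt h s) (scal (- 1) (vt 0 s)))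
    by (unfold plus, scal, mult; simpl; unfold mult; simpl; ring).
  eapply filterlim_comp_2; [exact D1| |apply (filterlim_plus (vt h s) (scal (-1) (vt 0 s)))].
  eapply filterlim_comp; [exact D2|apply (filterlim_scal_r (V := R_NormedModule))]. }
destruct (MVT_cor2 (fun z => vt z tau) (fun z => vtx z tau) 0 h) as [xi [E' Hxi]]; [lra| |].
{ intros z Hz. apply is_derive_Reals, Htx; [rewrite Rabs_pos_eq; lra|split; lra]. }
specialize (B xi tau ltac:(rewrite Rabs_pos_eq; lra) ltac:(lra)).
assert (Key : (v h t - v 0 t) / h - (v h 0 - v 0 0) / h = vtx xi tau * t).
{ apply Rmult_eq_reg_r with h; [|lra]. field_simplify; [|lra]. nra. }
apply Rabs_lt_between in B. apply Rabs_lt_between in B1. apply Rabs_lt_between in B2.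
apply Rabs_le.
assert (- (eps * t) <= vtx xi tau * t - vtx 0 0 * t <= eps * t) by nra.
lra.
Qed.

Lemma Ck_cyl_continuity n Omega T v x y t :
  Ck_cyl n Omega T v -> cyl Omega T (x, y, t) ->
  forall eps, 0 < eps -> exists d, 0 < d /\ forall x' y' t',
    Rabs (x' - x) < d -> Rabs (y' - y) < d -> Rabs (t' - t) < d ->
    cyl Omega T (x', y', t') -> Rabs (v x' y' t' - v x y t) < eps.
Proof.
intros H Hc eps He.
assert (L : filterlim (fun p : R * R * R => v (fst (fst p)) (snd (fst p)) (snd p))
       (within (cyl Omega T) (locally (x, y, t))) (locally (v x y t))).
{ destruct n; now apply H. }
destruct (proj1 (filterlim_locally _ _) L (mkposreal eps He)) as [d Hd].
exists d. split; [apply cond_pos|]. intros x' y' t' Hx Hy Ht Hc'.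
exact (Hd (x', y', t') (conj (conj Hx Hy) Ht) Hc').
Qed.

(** As [u] is of class C^2, the time derivative of its gradient at time 0 is the
    gradient of [u_t], and [u_t] is [E] there. *)
Lemma gradient_growth (Omega : R * R -> Prop) (T : R) (u : R -> R -> R -> R)
    (E : R -> R -> R) (p q Ex Ey : R) :
  open Omega -> Omega (0, 0) -> 0 < T -> Ck_cyl 2 Omega T u ->
  (forall x y, Omega (x, y) ->
     is_derive_within (time_interval T) (fun s => u x y s) 0 (E x y)) ->
  dx (fun a b => u a b 0) 0 0 = p -> dy (fun a b => u a b 0) 0 0 = q ->
  is_derive (fun z => E z 0) 0 Ex -> is_derive (fun z => E 0 z) 0 Ey ->
  forall eps, 0 < eps -> exists d, 0 < d <= T /\ forall t, 0 < t < d ->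
    Rabs (dx (fun a b => u a b t) 0 0 - p - Ex * t) <= eps * t /\
    Rabs (dy (fun a b => u a b t) 0 0 - q - Ey * t) <= eps * t.
Proof.
intros Ho H0 HT Hu HE Hp Hq HEx HEy eps He.
destruct Hu as [_ (ux & uy & ut & D & _ & _ & Hut)].
destruct Hut as [_ (utx & uty & utt & Dt & Hutx & Huty & _)].
assert (C0 : cyl Omega T (0, 0, 0)) by (split; [exact H0|split; simpl; lra]).
destruct (proj2 (locally_2d_locally (fun x y => Omega (x, y)) 0 0)) as [r Hr].
{ generalize (Ho (0, 0) H0). apply filter_imp. now intros [a b]. }
assert (R0 : Rabs (0 - 0) < r) by (rewrite Rminus_0_r, Rabs_R0; apply cond_pos).
assert (Rx : forall z, Rabs z < r -> Omega (z, 0)).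
{ intros z Hz. apply Hr; [now rewrite Rminus_0_r|exact R0]. }
assert (Ry : forall z, Rabs z < r -> Omega (0, z)).
{ intros z Hz. apply Hr; [exact R0|now rewrite Rminus_0_r]. }
assert (Eut : forall x y, Omega (x, y) -> ut x y 0 = E x y).
{ intros x y Hxy. apply (is_derive_within_right_unique T (fun s => u x y s)); trivial.
  - apply D. split; [exact Hxy|split; simpl; lra].
  - now apply HE. }
assert (EEx : utx 0 0 0 = Ex).
{ rewrite <- (is_derive_unique _ _ _ (proj1 (Dt 0 0 0 C0))).
  apply is_derive_unique. apply is_derive_ext_loc with (2 := HEx).
  exists r. intros z Hz. symmetry. apply Eut, Rx.
  replace z with (z + - 0) by ring. exact Hz. }
assert (EEy : uty 0 0 0 = Ey).
{ rewrite <- (is_derive_unique _ _ _ (proj1 (proj2 (Dt 0 0 0 C0)))).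
  apply is_derive_unique. apply is_derive_ext_loc with (2 := HEy).
  exists r. intros z Hz. symmetry. apply Eut, Ry.
  replace z with (z + - 0) by ring. exact Hz. }
assert (Eux : forall t, time_interval T t -> dx (fun a b => u a b t) 0 0 = ux 0 0 t).
{ intros t Ht. apply is_derive_unique, D. now split. }
assert (Euy : forall t, time_interval T t -> dy (fun a b => u a b t) 0 0 = uy 0 0 t).
{ intros t Ht. apply is_derive_unique, D. now split. }
assert (Near : forall v, Ck_cyl 0 Omega T v -> forall e, 0 < e ->
  exists d, 0 < d /\ forall x y s, Rabs x < d -> Rabs y < d -> 0 <= s < d ->
    Rabs (v x y s - v 0 0 0) < e).
{ intros v Hv e He'. destruct (Ck_cyl_continuity 0 Omega T v 0 0 0 Hv C0 e He') as [d [Hd B]].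
  set (m := Rmin d (Rmin r T)).
  assert (Hm1 : m <= d) by apply Rmin_l.
  assert (Hm2 : m <= r) by (eapply Rle_trans; [apply Rmin_r|apply Rmin_l]).
  assert (Hm3 : m <= T) by (eapply Rle_trans; [apply Rmin_r|apply Rmin_r]).
  exists m. split; [repeat apply Rmin_pos; trivial; apply cond_pos|].
  intros x y s Hx Hy Hs. apply B; rewrite ?Rminus_0_r; try lra.
  - rewrite Rabs_pos_eq; lra.
  - split; [apply Hr; simpl; rewrite Rminus_0_r; lra|split; simpl; lra]. }
destruct (space_derivative_time_expansion T r (fun z s => u z 0 s) (fun z s => ut z 0 s)
  (fun z s => utx z 0 s) (fun s => ux 0 0 s) HT (cond_pos r)) with (eps := eps)
  as [d1 [Hd1 B1]]; trivial.
{ intros s Hs. apply D. now split. }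
{ intros z s Hz Hs. apply D. split; [now apply Rx|exact Hs]. }
{ intros z s Hz Hs. apply Dt. split; [now apply Rx|exact Hs]. }
{ intros e He'. destruct (Near utx Hutx e He') as [d [Hd B]].
  exists d. split; [exact Hd|]. intros z s Hz Hs. apply B; trivial. now rewrite Rabs_R0. }
destruct (space_derivative_time_expansion T r (fun z s => u 0 z s) (fun z s => ut 0 z s)
  (fun z s => uty 0 z s) (fun s => uy 0 0 s) HT (cond_pos r)) with (eps := eps)
  as [d2 [Hd2 B2]]; trivial.
{ intros s Hs. apply D. now split. }
{ intros z s Hz Hs. apply D. split; [now apply Ry|exact Hs]. }
{ intros z s Hz Hs. apply Dt. split; [now apply Ry|exact Hs]. }
{ intros e He'. destruct (Near uty Huty e He') as [d [Hd B]].
  exists d. split; [exact Hd|]. intros z s Hz Hs. apply B; trivial. now rewrite Rabs_R0. }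
exists (Rmin d1 d2).
pose proof (Rmin_l d1 d2). pose proof (Rmin_r d1 d2).
split; [split; [apply Rmin_pos|]; lra|]. intros t Ht.
rewrite <- Hp, <- Hq, <- EEx, <- EEy, !Eux, !Euy by (trivial; split; lra).
split; [apply B1|apply B2]; lra.
Qed.

(** * The theorem *)

Theorem theorem2p4 :
  forall phi : R -> R,
  smooth phi -> even_fun phi -> Derive phi 1 > 0 -> Derive_n phi 2 1 = 0 ->
  exists k1 k2 h1 h2 : R,
  forall (Omega : R * R -> Prop) (u0 : R -> R -> R),
  open Omega -> Omega (0, 0) ->
  (forall x y, Omega (x, y) -> ex_diff_n u0 3 x y) ->
  is_domin (locally (0, 0))
    (fun p : R * R => norm2 (fst p) (snd p) ^ 3)
    (fun p : R * R =>
       u0 (fst p) (snd p) -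
       (sqrt 2 / 2 * fst p + sqrt 2 / 2 * snd p
        + k1 * fst p ^ 2 + k2 * snd p ^ 2
        + h1 * fst p ^ 3 + h2 * snd p ^ 3)) ->
  (exists (delta a : R) (g : R -> R),
     delta > 0 /\ a > 0 /\
     (forall x y, - delta < x < delta -> - a < y < a -> Omega (x, y)) /\
     (forall x, - delta < x < delta -> - a < g x < a) /\
     convex_on (fun x => - delta < x < delta) g /\
     (forall x y, - delta < x < delta -> - a < y < a ->
        (grad_norm u0 x y > 1 <-> y > g x))) /\
  (forall (T : R) (u : R -> R -> R -> R),
     T > 0 ->
     Ck_cyl 2 Omega T u ->
     (forall x y t, cyl Omega T (x, y, t) ->
        is_derive_within (time_interval T) (fun s => u x y s) t
          (div_flux phi (fun a b => u a b t) x y)) ->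
     (forall x y, Omega (x, y) -> u x y 0 = u0 x y) ->
     exists t0 : R, 0 < t0 < T /\
       forall t, 0 < t < t0 -> grad_norm (fun a b => u a b t) 0 0 > 1).
Proof.
intros phi Hphi _ Hc Hphi2.
set (c := Derive phi 1) in *. set (d := Derive_n phi 3 1).
(* h2 is such that 3 c h2 = 10 c + 2 |d|, which exceeds 3 c - w (d - 3 c) for every
   w between 0 and 2, in particular for w = sqrt 2. *)
exists 0, 1, (- 1), (1 + (7 * c + 2 * Rabs d) / (3 * c)).
set (h2 := 1 + (7 * c + 2 * Rabs d) / (3 * c)).
intros Omega u0 Ho H0 Hu0 Hdom.
assert (Loc : locally_2d (ex_diff_n u0 3) 0 0) by now apply (open_ex_diff_n Omega).
destruct (jet_of_expansion u0 _ _ _ _ _ _ Loc Hdom)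
  as ((Ep & Eq) & (Epx & Eqx & Eqy) & (E30 & E21 & E12 & E03)).
rewrite Rmult_0_r in Epx. rewrite Rmult_1_r in Eqy.
split.
{ apply superlevel_of_jet; trivial; lra. }
intros T u HT Hu Heq Hinit.
destruct (div_flux_gradient_at_jet phi u0 (- 1) h2 Hphi Hphi2 Loc) as [DEx DEy]; auto.
fold c d in DEx, DEy.
assert (Ext : forall x y, Omega (x, y) -> locally_2d (fun a b => u0 a b = u a b 0) x y).
{ intros x y Hxy. apply (locally_2d_locally (fun a b => u0 a b = u a b 0)).
  generalize (Ho (x, y) Hxy). apply filter_imp. intros [a b] Hab. symmetry. now apply Hinit. }
assert (HEx : 3 * c * h2 = 10 * c + 2 * Rabs d) by (unfold h2; field; lra).
pose proof (sqrt_sqrt 2 ltac:(lra)) as Hw2.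
assert (Hw : 0 < sqrt 2 < 2).
{ split; [apply sqrt_lt_R0; lra|]. pose proof (sqrt_pos 2). nra. }
set (w := sqrt 2) in *.
set (Ex := 3 * c * - 1) in *. set (Ey := 3 * c * h2 + w * (d - 3 * c)) in *.
assert (Hsum : 0 < Ex + Ey).
{ unfold Ex, Ey. rewrite HEx.
  pose proof (Rle_abs (- d)) as Q. rewrite Rabs_Ropp in Q. pose proof (Rabs_pos d). nra. }
destruct (gradient_growth Omega T u (div_flux phi u0) (w / 2) (w / 2) Ex Ey Ho H0 HT Hu)
  with (eps := (Ex + Ey) / 4) as [t0 [Ht0 B]]; trivial.
- intros x y Hxy. rewrite (div_flux_ext_loc phi u0 (fun a b => u a b 0) x y) by now apply Ext.
  apply Heq. split; [exact Hxy|split; simpl; lra].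
- rewrite <- Ep. symmetry. apply Derive_ext_loc.
  exact (locally_2d_1d_const_y _ _ _ (Ext 0 0 H0)).
- rewrite <- Eq. symmetry. apply Derive_ext_loc.
  exact (locally_2d_1d_const_x _ _ _ (Ext 0 0 H0)).
- lra.
- exists (t0 / 2). split; [lra|]. intros t Ht.
  destruct (B t ltac:(lra)) as [B1 B2].
  apply Rabs_le_between in B1. apply Rabs_le_between in B2.
  apply grad_norm_gt_1.
  set (P := dx (fun a b => u a b t) 0 0) in *. set (Q := dy (fun a b => u a b t) 0 0) in *.
  (* P ^ 2 + Q ^ 2 >= (P + Q) ^ 2 / 2, so the sum of the components is enough *)
  assert (HPQ : P + Q > w) by nra.
  assert ((P + Q) * (P + Q) > 2) by nra.
  pose proof (Rle_0_sqr (P - Q)) as S. unfold Rsqr in S. lra.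
Qed.
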